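(* Consider the two-cell MIMO reverse-TDD cellular network described in the context, with channel entries drawn i.i.d. from a continuous distribution, and a tuple of positive integers $(d_{\alpha 1},\dots,d_{\alpha K},d_{\beta 1},\dots,d_{\beta L})$ with $d_{\alpha k}\le N_{\alpha k}$, $d_{\beta l}\le N_{\beta l}$. Suppose $$\sum_{k=1}^K d_{\alpha k}\le M_\alpha,\qquad \sum_{l=1}^L d_{\beta l}\le M_\beta,\qquad \sum_{k=1}^K d_{\alpha k}+\sum_{l=1}^L d_{\beta l}\le\max(M_\alpha,M_\beta),$$ and that the matrix $\mathbf G_\alpha$ defined in the context has full row rank. Then the tuple is feasible almost surely.
   Context: Network model: Cell $\alpha$ operates in downlink: BS $\alpha$ with $M_\alpha$ antennas transmits to users $(\alpha,k)$, $k\in[1:K]$, user $(\alpha,k)$ having $N_{\alpha k}$ antennas. Cell $\beta$ operates in uplink: users $(\beta,l)$, $l\in[1:L]$, with $N_{\beta l}$ antennas transmit to BS $\beta$ with $M_\beta$ antennas. Received signals: $\mathbf y_{\alpha k}=\mathbf H_{\alpha k}\mathbf x_\alpha+\sum_{l=1}^L\mathbf G_{\alpha kl}\mathbf x_{\beta l}+\mathbf z_{\alpha k}$ and $\mathbf y_\beta=\sum_{l=1}^L\mathbf H_{\beta l}\mathbf x_{\beta l}+\mathbf G_\beta\mathbf x_\alpha+\mathbf z_\beta$, where $\mathbf H_{\alpha k}\in\mathbb C^{N_{\alpha k}\times M_\alpha}$, $\mathbf G_{\alpha kl}\in\mathbb C^{N_{\alpha k}\times N_{\beta l}}$, $\mathbf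 H_{\beta l}\in\mathbb C^{M_\beta\times N_{\beta l}}$, $\mathbf G_\beta\in\mathbb C^{M_\beta\times M_\alpha}$, all entries i.i.d. from a continuous distribution. Feasibility: the tuple is feasible if there exist $\mathbf V_{\alpha k}\in\mathbb C^{M_\alpha\times d_{\alpha k}}$, $\mathbf U_{\alpha k}\in\mathbb C^{N_{\alpha k}\times d_{\alpha k}}$, $\mathbf V_{\beta l}\in\mathbb C^{N_{\beta l}\times d_{\beta l}}$, $\mathbf U_{\beta l}\in\mathbb C^{M_\beta\times d_{\beta l}}$ with $\mathbf U_{\alpha k}^\dagger\mathbf G_{\alpha kl}\mathbf V_{\beta l}=\mathbf 0$ ($\forall k,l$), $\mathbf U_{\beta l}^\dagger\mathbf G_\beta\mathbf V_{\alpha k}=\mathbf 0$ ($\forall k,l$), $\mathbf U_{\alpha k}^\dagger\mathbf H_{\alpha k}\mathbf V_{\alpha i}=\mathbf 0$ ($\forall i\ne k$), $\mathbf U_{\beta l}^\dagger\mathbf H_{\beta j}\mathbf V_{\beta j}=\mathbf 0$ ($\forall j\ne l$), $\mathrm{rank}(\mathbf U_{\alpha k}^\dagger\mathbf H_{\alpha k}\mathbf V_{\alpha k})=d_{\alpha k}$, $\mathrm{rank}(\mathbf U_{\beta l}^\dagger\mathbf H_{\beta l}\mathbf V_{\beta l})=d_{\beta l}$ ($\dagger$ = conjugate transpose). Definition of $\mathbf G_\alpha$: Partition $\mathbf G_{\alpha kl}=\begin{bmatrix}\mathbf G^{(1)}_{\alpha kl}&\mathbf G^{(2)}_{\alpha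 kl}\\ \mathbf G^{(3)}_{\alpha kl}&\mathbf G^{(4)}_{\alpha kl}\end{bmatrix}$ with $\mathbf G^{(1)}_{\alpha kl}\in\mathbb C^{d_{\alpha k}\times d_{\beta l}}$, $\mathbf G^{(2)}_{\alpha kl}\in\mathbb C^{d_{\alpha k}\times(N_{\beta l}-d_{\beta l})}$, $\mathbf G^{(3)}_{\alpha kl}\in\mathbb C^{(N_{\alpha k}-d_{\alpha k})\times d_{\beta l}}$, $\mathbf G^{(4)}_{\alpha kl}\in\mathbb C^{(N_{\alpha k}-d_{\alpha k})\times(N_{\beta l}-d_{\beta l})}$. For a matrix $\mathbf A$ and $n\in\mathbb N$, $\mathrm{diag}[n](\mathbf A)$ is the block-diagonal matrix with $n$ diagonal blocks all equal to $\mathbf A$; $\mathbf A[i]$ is the $i$-th row of $\mathbf A$. Set $\mathbf G'_{\alpha kl}=\mathrm{diag}[d_{\alpha k}]\big((\mathbf G^{(3)}_{\alpha kl})^T\big)$ (size $d_{\alpha k}d_{\beta l}\times d_{\alpha k}(N_{\alpha k}-d_{\alpha k})$) and $\mathbf G''_{\alpha kl}$ the vertical stack of $\mathrm{diag}[d_{\beta l}](\mathbf G^{(2)}_{\alpha kl}[1]),\dots,\mathrm{diag}[d_{\beta l}](\mathbf G^{(2)}_{\alpha kl}[d_{\alpha k}])$ (size $d_{\alpha k}d_{\beta l}\times d_{\beta l}(N_{\beta l}-d_{\beta l})$). Then $\mathbf G_\alpha$ is the block matrix with $KL$ block rows indexed by $(k,l)$ in the order $(1,1),(1,2),\dots,(1,L),(2,1),\dots,(K,L)$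 and $K+L$ block columns, where block row $(k,l)$ has $\mathbf G'_{\alpha kl}$ in block column $k$, $\mathbf G''_{\alpha kl}$ in block column $K+l$, and zero blocks elsewhere (block column $k\le K$ has width $d_{\alpha k}(N_{\alpha k}-d_{\alpha k})$, block column $K+l$ has width $d_{\beta l}(N_{\beta l}-d_{\beta l})$). *)

(* Defs.v *)
From HB Require Import structures.
From mathcomp Require Import all_boot all_order all_algebra.
From mathcomp Require Import all_classical all_reals all_analysis.
From mathcomp Require Import complex.

Set Implicit Arguments.
Unset Strict Implicit.
Unset Printing Implicit Defensive.

Import Order.TTheory GRing.Theory Num.Theory.
Local Open Scope ring_scope.
Local Open Scope classical_set_scope.

Section Deterministic.
Variable R : rcfType.

Definition ctr (m n : nat) (A : 'M[R[i]]_(m, n)) : 'M[R[i]]_(n, m) :=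
  (map_mx conjc A)^T.

Definition mxnat (m n : nat) (A : 'M[R[i]]_(m, n)) (i j : nat) : R[i] :=
  match (insub i : option 'I_m), (insub j : option 'I_n) with
  | Some i', Some j' => A i' j'
  | _, _ => 0
  end.

Variables (K L Ma Mb : nat) (Na : 'I_K -> nat) (Nb : 'I_L -> nat).

Record channel := Channel {
  Ha : forall k : 'I_K, 'M[R[i]]_(Na k, Ma);
  Ga : forall (k : 'I_K) (l : 'I_L), 'M[R[i]]_(Na k, Nb l);
  Hb : forall l : 'I_L, 'M[R[i]]_(Mb, Nb l);
  Gb : 'M[R[i]]_(Mb, Ma) }.

Variables (da : 'I_K -> nat) (db : 'I_L -> nat).

Definition feasible (ch : channel) : Prop :=
  exists (Va : forall k : 'I_K, 'M[R[i]]_(Ma, da k))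
         (Ua : forall k : 'I_K, 'M[R[i]]_(Na k, da k))
         (Vb : forall l : 'I_L, 'M[R[i]]_(Nb l, db l))
         (Ub : forall l : 'I_L, 'M[R[i]]_(Mb, db l)),
  [/\ (forall k l, ctr (Ua k) *m Ga ch k l *m Vb l = 0),
      (forall k l, ctr (Ub l) *m Gb ch *m Va k = 0),
      (forall k i, i != k -> ctr (Ua k) *m Ha ch k *m Va i = 0),
      (forall l j, j != l -> ctr (Ub l) *m Hb ch j *m Vb j = 0) &
      ((forall k, \rank (ctr (Ua k) *m Ha ch k *m Va k) = da k) /\
       (forall l, \rank (ctr (Ub l) *m Hb ch l *m Vb l) = db l))].

(* Row index of G_alpha: block row (k,l), and inside the block the row
   a * d_{beta l} + b  (a < d_{alpha k}, b < d_{beta l}); the lexicographic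
   enumeration of this finite type is exactly the row order of the paper. *)
Definition GaRow := {k : 'I_K & {l : 'I_L & prod 'I_(da k) 'I_(db l)}}.

(* Column index of G_alpha: block column k <= K, inner column
   a' * (N_{alpha k} - d_{alpha k}) + e, or block column K + l, inner column
   b' * (N_{beta l} - d_{beta l}) + e; again enumerated lexicographically. *)
Definition GaCol :=
  ({k : 'I_K & prod 'I_(da k) 'I_(Na k - da k)} +
   {l : 'I_L & prod 'I_(db l) 'I_(Nb l - db l)})%type.

(* Entries of G_alpha.
   G'_{alpha k l} = diag[d_{alpha k}]((G^(3)_{alpha k l})^T): entry at
     (a*d_{beta l} + b, a'*(N_{alpha k}-d_{alpha k}) + e) is
     [a = a'] * G^(3)[e][b] = [a = a'] * G_{alpha k l}[d_{alpha k} + e][b].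
   G''_{alpha k l} = stack_a diag[d_{beta l}](G^(2)[a]): entry at
     (a*d_{beta l} + b, b'*(N_{beta l}-d_{beta l}) + e) is
     [b = b'] * G^(2)[a][e] = [b = b'] * G_{alpha k l}[a][d_{beta l} + e]. *)
Definition Galpha_entry (G : forall (k : 'I_K) (l : 'I_L), 'M[R[i]]_(Na k, Nb l))
    (r : GaRow) (c : GaCol) : R[i] :=
  let: existT k (existT l (a, b)) := r in
  match c with
  | inl (existT k' (a', e)) =>
      if (k' == k) && (val a' == val a) then mxnat (G k l) (da k + e) b else 0
  | inr (existT l' (b', e)) =>
      if (l' == l) && (val b' == val b) then mxnat (G k l) a (db l + e) else 0
  end.

Definition Galpha (G : forall (k : 'I_K) (l : 'I_L), 'M[R[i]]_(Na k, Nb l)) :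
    'M[R[i]]_(#|{: GaRow}|, #|{: GaCol}|) :=
  \matrix_(i < #|{: GaRow}|, j < #|{: GaCol}|)
     Galpha_entry G (enum_val i) (enum_val j).

End Deterministic.

Inductive entry (K L Ma Mb : nat) (Na : 'I_K -> nat) (Nb : 'I_L -> nat) : Type :=
  | EHa (k : 'I_K) (i : 'I_(Na k)) (j : 'I_Ma)
  | EGa (k : 'I_K) (l : 'I_L) (i : 'I_(Na k)) (j : 'I_(Nb l))
  | EHb (l : 'I_L) (i : 'I_Mb) (j : 'I_(Nb l))
  | EGb (i : 'I_Mb) (j : 'I_Ma).

Definition channel_of (R : rcfType) (K L Ma Mb : nat) (Na : 'I_K -> nat)
    (Nb : 'I_L -> nat) (z : @entry K L Ma Mb Na Nb -> R[i]) :
    @channel R K L Ma Mb Na Nb :=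
  @Channel R K L Ma Mb Na Nb
    (fun k => \matrix_(i, j) z (@EHa K L Ma Mb Na Nb k i j))
    (fun k l => \matrix_(i, j) z (@EGa K L Ma Mb Na Nb k l i j))
    (fun l => \matrix_(i, j) z (@EHb K L Ma Mb Na Nb l i j))
    (\matrix_(i, j) z (@EGb K L Ma Mb Na Nb i j)).

Section Random.
Variable R : realType.

Definition toC (p : R * R) : R[i] := (p.1 +i* p.2)%C.

Definition lebesgue2 := ((@lebesgue_measure R) \x (@lebesgue_measure R))%E.

(* The family Z of complex random variables (each given as the pair of its real
   and imaginary parts) is i.i.d. with a continuous (i.e. absolutely continuous
   w.r.t. Lebesgue measure on C) common distribution. *)
Definition iid_continuous (d : measure_display) (T : measurableType d)
    (P : probability T R) (I : Type) (Z : I -> T -> R * R) : Prop :=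
  [/\ (forall i, measurable_fun setT (Z i)),
      (forall (n : nat) (f : 'I_n -> I), injective f ->
        forall A : 'I_n -> set (R * R), (forall j, measurable (A j)) ->
        P (\bigcap_j (Z (f j) @^-1` A j)) = (\prod_(j < n) P (Z (f j) @^-1` A j))%E),
      (forall i i' (A : set (R * R)), measurable A ->
        P (Z i @^-1` A) = P (Z i' @^-1` A)) &
      (forall i (A : set (R * R)), measurable A -> lebesgue2 A = 0%E ->
        P (Z i @^-1` A) = 0%E)].

End Random.

(* Main.v *)
Require Import Defs.
From HB Require Import structures.
From mathcomp Require Import all_boot all_order all_algebra.
From mathcomp Require Import all_classical all_reals all_analysis.
From mathcomp Require Import complex.
From mathcomp Require Import measurable_realfun closed_field ring.
Import Order.TTheory GRing.Theory Num.Theory.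
Local Open Scope classical_set_scope.

Set Implicit Arguments.
Unset Strict Implicit.
Unset Printing Implicit Defensive.

(* Feasibility contains the solvability of a polynomial system whose parameters
   are the channel coefficients.  By quantifier elimination over C, off the zero
   set of one nonzero polynomial such a system is always or never solvable, and
   the zero set of a nonzero polynomial is null for i.i.d. continuous
   coefficients (Fubini, one coefficient at a time).  So it suffices that the
   solvable channels are not contained in a hypersurface {D = 0}.

   Look for cross-cell filters [1 X_k] and [1; Y_l].  The equations read
   G1 = - (X G3 + G2 Y) - X G4 Y, whose linear part in (X, Y) has matrix Galpha.
   When Galpha has full row rank, the lowest-order term of D along the block G1
   does not vanish on the range of the linear part, so a suitable (X, Y) gives an
   aligned channel with D <> 0.  The filters at the larger base station and then
   the remaining ones are one-sided inverses of matrices depending on the other,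
   still free, coefficients. *)

(** * Polynomial functions of an arbitrary family of coordinates *)

Section PolynomialFunctions.
Local Open Scope ring_scope.

(** An inductive predicate rather than a type of multivariate polynomials: any index type [I] is
    allowed, and properties follow by induction on the derivation. *)
Inductive polyfun (F : comNzRingType) (I : Type) : ((I -> F) -> F) -> Prop :=
| polyfun_const c : polyfun (fun=> c)
| polyfun_coord i : polyfun (fun z => z i)
| polyfun_add f g : polyfun f -> polyfun g -> polyfun (fun z => f z + g z)
| polyfun_mul f g : polyfun f -> polyfun g -> polyfun (fun z => f z * g z).

Lemma polyfun_eq (F : comNzRingType) (I : Type) (f g : (I -> F) -> F) :
  f =1 g -> polyfun f -> polyfun g.
Proof. by move=> /funext ->. Qed.

Lemma polyfun_opp (F : comNzRingType) (I : Type) (f : (I -> F) -> F) :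
  polyfun f -> polyfun (fun z => - f z).
Proof.
move=> pf; apply: (@polyfun_eq _ _ (fun z => -1 * f z)).
  by move=> z; rewrite mulN1r.
exact: polyfun_mul (polyfun_const _ _) pf.
Qed.

Lemma polyfun_sum (F : comNzRingType) (I : Type) (J : Type) (s : seq J)
    (P : pred J) (f : J -> (I -> F) -> F) :
  (forall j, polyfun (f j)) -> polyfun (fun z => \sum_(j <- s | P j) f j z).
Proof.
move=> pf; elim: s => [|j s IHs].
  apply: polyfun_eq (polyfun_const _ 0) => z; by rewrite big_nil.
case Pj: (P j).
  apply: polyfun_eq (polyfun_add (pf j) IHs) => z; by rewrite big_cons Pj.
by apply: polyfun_eq IHs => z; rewrite big_cons Pj.
Qed.

Lemma polyfun_prod (F : comNzRingType) (I : Type) (J : Type) (s : seq J)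
    (P : pred J) (f : J -> (I -> F) -> F) :
  (forall j, polyfun (f j)) -> polyfun (fun z => \prod_(j <- s | P j) f j z).
Proof.
move=> pf; elim: s => [|j s IHs].
  apply: polyfun_eq (polyfun_const _ 1) => z; by rewrite big_nil.
case Pj: (P j).
  apply: polyfun_eq (polyfun_mul (pf j) IHs) => z; by rewrite big_cons Pj.
by apply: polyfun_eq IHs => z; rewrite big_cons Pj.
Qed.

Lemma polyfun_exp (F : comNzRingType) (I : Type) (f : (I -> F) -> F) n :
  polyfun f -> polyfun (fun z => f z ^+ n).
Proof.
move=> pf; apply: (@polyfun_eq _ _ (fun z => \prod_(j < n) f z)).
  by move=> z; rewrite prodr_const card_ord.
exact: polyfun_prod.
Qed.

Definition polyfun_mx (F : comNzRingType) (I : Type) m n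
    (A : (I -> F) -> 'M[F]_(m, n)) := forall i j, polyfun (fun z => A z i j).

Lemma polyfun_mulmx (F : comNzRingType) (I : Type) m n p
    (A : (I -> F) -> 'M[F]_(m, n)) (B : (I -> F) -> 'M[F]_(n, p)) :
  polyfun_mx A -> polyfun_mx B -> polyfun_mx (fun z => A z *m B z).
Proof.
move=> pA pB i j.
apply: (@polyfun_eq _ _ (fun z => \sum_k A z i k * B z k j)).
  by move=> z; rewrite mxE.
by apply: polyfun_sum => k; apply: polyfun_mul.
Qed.

Lemma polyfun_mx_const (F : comNzRingType) (I : Type) m n (A : 'M[F]_(m, n)) :
  polyfun_mx (fun _ : I -> F => A).
Proof. by move=> i j; exact: polyfun_const. Qed.

Lemma polyfun_det (F : comNzRingType) (I : Type) n
    (A : (I -> F) -> 'M[F]_n) :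
  polyfun_mx A -> polyfun (fun z => \det (A z)).
Proof.
move=> pA; apply: polyfun_sum => s; apply: polyfun_mul.
  exact: polyfun_const.
by apply: polyfun_prod => i; apply: pA.
Qed.

(** The outer variable of [B] carries the order in [x], and its coefficients are polynomials in [e].
    This lets [polyfun_dominant] compare orders in [x] before substituting [e = x]. *)
Lemma polyfun_plane (F : comNzRingType) (I : Type) (f : (I -> F) -> F)
    (z u v : I -> F) :
  polyfun f -> exists B : {poly {poly F}}, forall x e,
    f (fun i => z i + x * (u i + e * v i)) = B.[x%:P].[e].
Proof.
elim=> [c|i|g h _ [B HB] _ [B' HB']|g h _ [B HB] _ [B' HB']].
- by exists c%:P%:P => x e; rewrite !hornerC.
- exists ((z i)%:P%:P + 'X * ((u i)%:P + (v i) *: 'X)%:P) => x e.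
  by rewrite !(hornerE, hornerM, hornerD, hornerC, hornerX, hornerZ) [e * _]mulrC.
- by exists (B + B') => x e; rewrite HB HB' !hornerD.
- by exists (B * B') => x e; rewrite HB HB' !hornerM.
Qed.

Lemma polyfun_line (F : comNzRingType) (I : Type) (f : (I -> F) -> F)
    (z u : I -> F) :
  polyfun f -> exists p : {poly F}, forall x,
    f (fun i => z i + x * u i) = p.[x].
Proof.
move=> /(polyfun_plane z u (fun=> 0))[B HB].
exists (map_poly (horner_eval 0) B) => x.
rewrite -[x in RHS](hornerC x 0) -[_.[0]]/(horner_eval 0 _) horner_map /=.
by rewrite /horner_eval -HB; congr (f _); apply: funext => i; rewrite mulr0 addr0.
Qed.

(** On the line through [z1] and [z2] both functions become nonzero polynomials in one variable, and
    their product has a non-root. Coordinates on which the endpoints agree stay constant along the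
    line. *)
Lemma polyfun_mul_neq0 (F : closedFieldType) (I : Type) (f g : (I -> F) -> F)
    (z1 z2 : I -> F) :
  polyfun f -> polyfun g -> f z1 != 0 -> g z2 != 0 ->
  exists z, [/\ f z != 0, g z != 0 & forall i, z1 i = z2 i -> z i = z1 i].
Proof.
pose u i := z2 i - z1 i.
move=> /(polyfun_line z1 u)[p Hp] /(polyfun_line z1 u)[q Hq] f1 g2.
have p0 : p.[0] != 0.
  rewrite -Hp; move: f1; congr (f _ != _).
  by apply: funext => i; rewrite mul0r addr0.
have q1 : q.[1] != 0.
  rewrite -Hq; move: g2; congr (g _ != _).
  by apply: funext => i; rewrite mul1r /u addrC subrK.
have : p * q != 0.
  rewrite mulf_neq0 //.
    by apply: contraNneq p0 => ->; rewrite horner0.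
  by apply: contraNneq q1 => ->; rewrite horner0.
move=> /closed_nonrootP[x]; rewrite /root hornerM mulf_eq0 negb_or => /andP[px qx].
exists (fun i => z1 i + x * u i); rewrite Hp Hq; split => // i e.
by rewrite /u e subrr mulr0 addr0.
Qed.

(* By [closed] the quadratic part takes its values in the range of [L].  Hence if
   [r] is the least order in [x] of [f (z + x L t)] over all [t], the term of
   order [r] of [f (z + x L t + x^2 Q t)] involves [L] only. *)
Lemma polyfun_dominant (F : closedFieldType) (I T : Type) (f : (I -> F) -> F)
    (z : I -> F) (scale : F -> T -> T) (L Q : T -> I -> F) (t1 : T) :
  polyfun f ->
  (forall x t i, L (scale x t) i = x * L t i) ->
  (forall x t i, Q (scale x t) i = x ^+ 2 * Q t i) ->
  (forall x t, exists t', forall i, L t i + x * Q t i = L t' i) ->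
  f (fun i => z i + L t1 i) != 0 ->
  exists t, f (fun i => z i + L t i + Q t i) != 0.
Proof.
move=> pf LZ QZ closed ft1.
have line t : exists p : {poly F}, forall x, f (fun i => z i + x * L t i) = p.[x].
  exact: polyfun_line.
pose hascoef r := `[< exists t (p : {poly F}),
  (forall x, f (fun i => z i + x * L t i) = p.[x]) /\ p`_r != 0 >].
have hex : exists r, hascoef r.
  have [p Hp] := line t1.
  have p0 : p != 0.
    apply: contraNneq ft1 => p0.
    suff -> : (fun i => z i + L t1 i) = (fun i => z i + 1 * L t1 i).
      by rewrite Hp p0 horner0.
    by apply: funext => i; rewrite mul1r.
  exists (size p).-1; apply/asboolP; exists t1, p; split => //.
  by rewrite -lead_coefE lead_coef_eq0.
have [r /asboolP[t0 [p [Hp pr]]] rmin] := ex_minnP hex.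
have [B HB] := polyfun_plane z (L t0) (Q t0) pf.
(* For fixed [e], [closed] turns the direction [L t0 + e Q t0] into some [L t'], so a nonzero
   coefficient of order [j < r] would contradict the minimality of [r]. *)
have Bsmall j : (j < r)%N -> B`_j = 0.
  move=> jr; apply/eqP/negPn/negP => /closed_nonrootP[e].
  rewrite /root => /negP; apply.
  have [t' Ht'] := closed e t0.
  apply: contraLR jr; rewrite -leqNgt => Bj; apply: rmin.
  apply/asboolP; exists t', (map_poly (horner_eval e) B); split; last first.
    by rewrite coef_map.
  move=> x; rewrite -[x in RHS](hornerC x e) -[_.[e]]/(horner_eval e _).
  rewrite horner_map /= /horner_eval -HB; congr (f _).
  by apply: funext => i; rewrite Ht'.
have Br : (B`_r).[0] = p`_r.
  suff <- : map_poly (horner_eval 0) B = p by rewrite coef_map.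
  apply/eqP; rewrite -subr_eq0; apply/negPn/negP => /closed_nonrootP[x].
  rewrite /root hornerD hornerN -Hp => /eqP; apply.
  apply/eqP; rewrite subr_eq0; apply/eqP.
  rewrite -[x in LHS](hornerC x 0) -[_.[0]]/(horner_eval 0 _) horner_map /=.
  rewrite /horner_eval -HB; congr (f _); apply: funext => i.
  by rewrite mul0r addr0.
(* After substituting [e = x], only coefficients of [B] of index at most [r] reach order [r]. Those
   below [r] vanish, which leaves the constant term of the coefficient of index [r]. *)
have qr : (B.['X])`_r != 0.
  rewrite horner_coef coef_sum.
  have [rB|Br0] := ltnP r (size B); last first.
    by move: pr; rewrite -Br (nth_default _ Br0) horner0 eqxx.
  rewrite (bigD1 (Ordinal rB)) //= coefMXn ltnn subnn -horner_coef0 Br.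
  rewrite big1 ?addr0 // => j jr; rewrite coefMXn.
  case: ltnP => // jler; rewrite Bsmall ?coef0 //.
  by rewrite ltn_neqAle jler andbT; apply: contraNneq jr => jr; apply/eqP/val_inj.
have : B.['X] != 0 by apply: contraNneq qr => ->; rewrite coef0.
move=> /closed_nonrootP[x]; rewrite /root => Bx.
(* By homogeneity, scaling [t0] by [x] yields [x L t0 + x^2 Q t0], the direction already evaluated
   by [B] at [e = x]. *)
exists (scale x t0); apply: contraNneq Bx => f0; apply/eqP.
have -> : B.['X].[x] = B.[x%:P].[x].
  rewrite -[LHS]/(horner_eval x _) -[RHS]/(horner_eval x _).
  by rewrite -!horner_map /= /horner_eval hornerX hornerC.
rewrite -HB -f0; congr (f _); apply: funext => i.
by rewrite LZ QZ mulrDr -addrA mulrA expr2.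
Qed.

(** With [C] held fixed, [\det (B z *m C)] is a polynomial equal to [1] at [z2]; wherever it is
    nonzero, [B z] has a right inverse. *)
Lemma polyfun_rinv (F : closedFieldType) (I : Type) (f : (I -> F) -> F)
    m n (B : (I -> F) -> 'M[F]_(m, n)) (z1 z2 : I -> F) (C : 'M[F]_(n, m)) :
  polyfun f -> polyfun_mx B -> f z1 != 0 -> B z2 *m C = 1%:M ->
  exists z, [/\ f z != 0, (exists X, B z *m X = 1%:M) &
                forall i, z1 i = z2 i -> z i = z1 i].
Proof.
move=> pf pB fz1 BC.
have pE : polyfun (fun z => \det (B z *m C)).
  by apply: polyfun_det; apply: polyfun_mulmx => //; apply: polyfun_mx_const.
have E2 : \det (B z2 *m C) != 0 by rewrite BC det1 oner_eq0.
have [z [fz Ez zE]] := polyfun_mul_neq0 pf pE fz1 E2.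
exists z; split=> //; exists (C *m invmx (B z *m C)).
by rewrite mulmxA mulmxV // unitmxE unitfE.
Qed.

End PolynomialFunctions.

(** * Generic truth values of formulas over an algebraically closed field *)

Section QuantifierElimination.
Local Open Scope ring_scope.
Variable F : closedFieldType.

(** An atomic equation either holds identically or fails off the zero set of the difference of its
    sides. Binary connectives multiply the two polynomials [D]. *)
Lemma qf_generic (I : Type) (env : (I -> F) -> seq F) (phi : GRing.formula F) :
  (forall n, polyfun (fun z => (env z)`_n)) ->
  GRing.qf_form phi -> GRing.rformula phi ->
  exists (b : bool) (D : (I -> F) -> F), [/\ polyfun D, exists z, D z != 0 &
    forall z, D z != 0 -> GRing.qf_eval (env z) phi = b].
Proof.
move=> penv.
have pterm t : GRing.rterm t -> polyfun (fun z => GRing.eval (env z) t).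
  elim: t => //= [c _|n _|t1 IH1 t2 IH2 /andP[/IH1 ? /IH2 ?]|t IH /IH ?|t IH n /IH ?|
      t1 IH1 t2 IH2 /andP[/IH1 ? /IH2 ?]|t IH n /IH ?].
  - exact: polyfun_const.
  - exact: polyfun_const.
  - exact: polyfun_add.
  - exact: polyfun_opp.
  - apply: (@polyfun_eq _ _ (fun z => n%:R * GRing.eval (env z) t)).
      by move=> z; rewrite mulr_natl.
    by apply: polyfun_mul => //; apply: polyfun_const.
  - exact: polyfun_mul.
  - exact: polyfun_exp.
have comb (D1 D2 : (I -> F) -> F) : polyfun D1 -> polyfun D2 ->
    (exists z, D1 z != 0) -> (exists z, D2 z != 0) ->
    polyfun (fun z => D1 z * D2 z) /\ exists z, D1 z * D2 z != 0.
  move=> p1 p2 [z1 D1z] [z2 D2z]; split; first exact: polyfun_mul.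
  have [z [? ? _]] := polyfun_mul_neq0 p1 p2 D1z D2z.
  by exists z; rewrite mulf_neq0.
elim: phi => //= [b _ _|t1 t2 _ /andP[r1 r2]|f1 IH1 f2 IH2|f1 IH1 f2 IH2|
    f1 IH1 f2 IH2|f IH qf rf].
- exists b, (fun=> 1); split=> //; first exact: polyfun_const.
  by exists (fun=> 0); apply: oner_neq0.
- pose D z := GRing.eval (env z) t1 - GRing.eval (env z) t2.
  have pD : polyfun D by apply: polyfun_add; [|apply: polyfun_opp]; apply: pterm.
  have [[z Dz]|D0] := pselect (exists z, D z != 0).
    exists false, D; split=> //; first by exists z.
    by move=> z'; rewrite /D subr_eq0 => /negPf.
  exists true, (fun=> 1); split=> [| |z _]; first exact: polyfun_const.
    by exists (fun=> 0); apply: oner_neq0.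
  rewrite -subr_eq0; apply/eqP.
  by apply: contrapT => /eqP Dz; apply: D0; exists z.
- move=> /andP[q1 q2] /andP[r1 r2].
  have [b1 [D1 [pD1 nD1 H1]]] := IH1 q1 r1; have [b2 [D2 [pD2 nD2 H2]]] := IH2 q2 r2.
  have [pD nD] := comb _ _ pD1 pD2 nD1 nD2.
  exists (b1 && b2), (fun z => D1 z * D2 z); split=> // z.
  by rewrite mulf_eq0 negb_or => /andP[/H1 -> /H2 ->].
- move=> /andP[q1 q2] /andP[r1 r2].
  have [b1 [D1 [pD1 nD1 H1]]] := IH1 q1 r1; have [b2 [D2 [pD2 nD2 H2]]] := IH2 q2 r2.
  have [pD nD] := comb _ _ pD1 pD2 nD1 nD2.
  exists (b1 || b2), (fun z => D1 z * D2 z); split=> // z.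
  by rewrite mulf_eq0 negb_or => /andP[/H1 -> /H2 ->].
- move=> /andP[q1 q2] /andP[r1 r2].
  have [b1 [D1 [pD1 nD1 H1]]] := IH1 q1 r1; have [b2 [D2 [pD2 nD2 H2]]] := IH2 q2 r2.
  have [pD nD] := comb _ _ pD1 pD2 nD1 nD2.
  exists (b1 ==> b2), (fun z => D1 z * D2 z); split=> // z.
  by rewrite mulf_eq0 negb_or => /andP[/H1 -> /H2 ->].
- have [b [D [pD nD H]]] := IH qf rf.
  by exists (~~ b), D; split=> // z /H ->.
Qed.

Lemma polyfun_term (I : Type) (enc : I -> nat) (f : (I -> F) -> F) :
  polyfun f -> exists t : GRing.term F, GRing.rterm t /\
    forall e : seq F, GRing.eval e t = f (fun i => e`_(enc i)).
Proof.
elim=> [c|i|g h _ [t [rt tE]] _ [s [rs sE]]|g h _ [t [rt tE]] _ [s [rs sE]]].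
- by exists (GRing.Const c).
- by exists (GRing.Var F (enc i)).
- by exists (GRing.Add t s); rewrite /= rt rs; split=> // e; rewrite tE sE.
- by exists (GRing.Mul t s); rewrite /= rt rs; split=> // e; rewrite tE sE.
Qed.

(* Generically a polynomial system is either solvable or unsolvable
   (elimination theory); hence density of the solvable parameters suffices. *)
Lemma generic_solvable (I J Q : finType) (f : Q -> ((I + J)%type -> F) -> F) :
  (forall q, polyfun (f q)) ->
  let solvable (z : I -> F) := exists t : J -> F,
     forall q, f q (fun x => match x with inl i => z i | inr j => t j end) = 0 in
  (forall D, polyfun D -> (exists z, D z != 0) ->
     exists2 z : I -> F, D z != 0 & solvable z) ->
  exists D, [/\ polyfun D, exists z, D z != 0 & forall z, D z != 0 -> solvable z].
Proof.
move=> pf solvable dense.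
(* Parameters occupy the variables below [#|I|]; the unknowns are the next [#|J|], exactly those
   bound in [phi]. *)
pose enc (x : (I + J)%type) : nat :=
  match x with inl i => enum_rank i | inr j => #|I| + enum_rank j end.
have /boolp.choice[t tP] q := polyfun_term enc (pf q).
pose body := foldr (fun q p => GRing.And (GRing.Equal (t q) (GRing.Const 0)) p)
               (GRing.Bool true) (enum Q).
pose phi := foldr (@GRing.Exists F) body (iota #|I| #|J|).
have rphi : GRing.rformula phi.
  rewrite /phi; elim: (iota _ _) => //=.
  rewrite /body; elim: (enum Q) => //= q s ->; rewrite !andbT.
  by have [] := tP q.
have bodyP e : GRing.holds e body <-> forall q, f q (fun x => e`_(enc x)) = 0.
  have -> : (forall q, f q (fun x => e`_(enc x)) = 0) <->
            (forall q, q \in enum Q -> f q (fun x => e`_(enc x)) = 0).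
    by split=> [H q _|H q]; apply: H; rewrite ?mem_enum.
  rewrite /body; elim: (enum Q) => //= q s IH; split.
    move=> [tq /IH H] q'; rewrite inE => /predU1P[->|/H //].
    by have [_ <-] := tP q.
  move=> H; split.
    by have [_ ->] := tP q; apply: H; rewrite inE eqxx.
  by apply/IH => q' q's; apply: H; rewrite inE q's orbT.
pose env (z : I -> F) := [seq z i | i <- enum I].
have envI z i : (env z)`_(enum_rank i) = z i.
  by rewrite (nth_map i) ?nth_enum_rank // -cardE ltn_ord.
have phiP z : GRing.holds (env z) phi <-> solvable z.
  rewrite -GRing.foldExistsP; split=> [[e ez /bodyP He]|[s Hs]].
    exists (fun j => e`_(enc (inr j))) => q.
    rewrite -[RHS](He q); congr (f q _); apply: funext => -[i|j] //.
    by rewrite /= -ez ?envI // inE /= mem_iota negb_and -ltnNge ltn_ord.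
  (* The parameters are followed by the solution; past both lists the default [0] agrees with that
     of [env z]. *)
  exists (env z ++ [seq s j | j <- enum J]).
    move=> n; rewrite inE /= mem_iota negb_and -ltnNge -leqNgt nth_cat size_map -cardE.
    case: ltnP => //= le1 le2.
    have -> : (env z)`_n = 0 by rewrite nth_default // size_map -cardE.
    by rewrite nth_default // size_map -cardE leq_subRL.
  apply/bodyP => q; rewrite -[RHS](Hs q); congr (f q _).
  apply: funext => -[i|j] /=; rewrite nth_cat size_map -cardE.
    by rewrite ltn_ord envI.
  rewrite ltnNge leq_addr /= addKn (nth_map j) ?nth_enum_rank //.
  by rewrite -cardE ltn_ord.
have penv n : polyfun (fun z => (env z)`_n).
  have [nI|nI] := ltnP n #|I|; last first.
    apply: polyfun_eq (polyfun_const _ 0) => z.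
    by rewrite nth_default // size_map -cardE.
  apply: (@polyfun_eq _ _ (fun z => z (enum_val (Ordinal nI)))).
    by move=> z; rewrite -envI enum_valK.
  exact: polyfun_coord.
pose qe := GRing.quantifier_elim (@ClosedFieldQE.ex_elim F).
have F_closed : GRing.closed_field_axiom F := @solve_monicpoly F.
have qeP z : reflect (solvable z) (GRing.qf_eval (env z) (qe phi)).
  have := GRing.quantifier_elim_rformP (@ClosedFieldQE.wf_ex_elim F)
    (ClosedFieldQE.holds_ex_elim F_closed) (env z) rphi.
  by move=> H; apply: (iffP H); apply phiP.
have /andP[qfqe rqe] := GRing.quantifier_elim_wf (@ClosedFieldQE.wf_ex_elim F) rphi.
have [b [D [pD nD HD]]] := qf_generic penv qfqe rqe.
exists D; split=> // z Dz; apply/qeP; rewrite HD //.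
(* Density provides a solvable point with [D <> 0], which forces the generic value [b] to be
   [true]. *)
have [z' Dz' /qeP] := dense D pD nD.
by rewrite HD.
Qed.

End QuantifierElimination.

(** * Zero sets of nonzero polynomials are null for i.i.d. continuous coordinates *)

Section GenericPoint.
Local Open Scope ring_scope.

(** Independence makes the joint law of [(X, Y)] a product measure; its value on [E] is the integral
    of the section measures, which vanish off the null set [N]. *)
Lemma xsection_null_prob (d d1 d2 : measure_display) (R : realType)
    (Omega : measurableType d) (T1 : measurableType d1) (T2 : measurableType d2)
    (P : probability Omega R) (X : {mfun Omega >-> T1}) (Y : {mfun Omega >-> T2})
    (E : set (T1 * T2)) (N : set T1) :
  (forall A B, measurable A -> measurable B ->
     P (X @^-1` A `&` Y @^-1` B) = (P (X @^-1` A) * P (Y @^-1` B))%E) ->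
  measurable E -> measurable N -> P (X @^-1` N) = 0%E ->
  (forall x, ~ N x -> P (Y @^-1` xsection E x) = 0%E) ->
  P [set w | E (X w, Y w)] = 0%E.
Proof.
move=> indep mE mN PN sec0.
have mXY : measurable_fun setT (fun w => (X w, Y w)).
  by apply: measurable_fun_pair; apply: measurable_funPT.
pose XY : {mfun Omega >-> (T1 * T2)%type} := mfun_Sub (mem_set mXY).
have -> : P [set w | E (X w, Y w)] = distribution P XY E by [].
rewrite -(@product_measure_unique _ _ _ _ _ (distribution P X) (distribution P Y)) //.
  rewrite /product_measure1.
  rewrite (ae_eq_integral (cst 0%E)) ?integral0 //.
  - exact: measurable_fun_xsection.
  - exists N; split=> // x /= H; apply: contrapT => nN; apply: H => _.
    exact: sec0.
Qed.

Lemma lebesgue2_set1 (R : realType) (p : R * R) : @lebesgue2 R [set p] = 0%E.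
Proof.
case: p => a b.
have -> : [set (a, b)] = [set a] `*` [set b].
  by apply/seteqP; split=> -[x y] /= [-> ->].
by rewrite /lebesgue2 product_measure1E //= lebesgue_measure_set1 mul0e.
Qed.

Lemma lebesgue2_toC_seq (R : realType) (s : seq R[i]) :
  measurable [set x : R * R | toC x \in s] /\
  @lebesgue2 R [set x | toC x \in s] = 0%E.
Proof.
elim: s => [|[a b] s [ms s0]].
  have -> : [set x : R * R | toC x \in [::]] = set0 by apply/seteqP; split.
  by split; rewrite ?measure0.
have -> : [set x : R * R | toC x \in (a +i* b)%C :: s] =
          [set (a, b)] `|` [set x | toC x \in s].
  apply/seteqP; split=> -[x y] /=; rewrite inE.
    by move=> /orP[/eqP[-> ->]|]; [left|right].
  by case=> [[-> ->]|->]; rewrite ?eqxx ?orbT.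
have m1 : measurable [set (a, b)].
  have -> : [set (a, b)] = [set a] `*` [set b].
    by apply/seteqP; split=> -[x y] /= [-> ->].
  exact: measurableX.
split; first exact: measurableU.
rewrite /lebesgue2 measureU0 //; first exact: lebesgue2_set1.
Qed.

Lemma measurable_polyfun (d : measure_display) (T : measurableType d)
    (R : realType) (I : Type) (D : (I -> R[i]) -> R[i]) (u : T -> I -> R[i]) :
  polyfun D ->
  (forall i, measurable_fun setT (fun t => complex.Re (u t i)) /\
             measurable_fun setT (fun t => complex.Im (u t i))) ->
  measurable [set t | D (u t) = 0].
Proof.
move=> pD mu.
have [mRe mIm] : measurable_fun setT (fun t => complex.Re (D (u t))) /\
                 measurable_fun setT (fun t => complex.Im (D (u t))).
  elim: pD => [c|i|f g _ [f1 f2] _ [g1 g2]|f g _ [f1 f2] _ [g1 g2]].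
  - by split; apply: measurable_cst.
  - exact: mu.
  - split.
      apply: eq_measurable_fun (measurable_funD f1 g1) => t _ /=.
      by case: (f _) (g _) => [? ?] [? ?].
    apply: eq_measurable_fun (measurable_funD f2 g2) => t _ /=.
    by case: (f _) (g _) => [? ?] [? ?].
  - split.
      apply: eq_measurable_fun (measurable_funB (measurable_funM f1 g1)
        (measurable_funM f2 g2)) => t _ /=.
      by case: (f _) (g _) => [? ?] [? ?].
    apply: eq_measurable_fun (measurable_funD (measurable_funM f1 g2)
        (measurable_funM f2 g1)) => t _ /=.
    by case: (f _) (g _) => [? ?] [? ?].
have -> : [set t | D (u t) = 0] =
    (fun t => complex.Re (D (u t))) @^-1` [set 0] `&`
    (fun t => complex.Im (D (u t))) @^-1` [set 0].
  apply/seteqP; split=> t /=; first by move=> ->.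
  by case: (D _) => a b /= [-> ->].
by apply: measurableI; rewrite -[X in measurable X]setTI; [apply: mRe|apply: mIm].
Qed.

Variables (R : realType) (d : measure_display) (Omega : measurableType d).
Variables (P : probability Omega R) (I : Type) (Z : I -> Omega -> R * R).
Hypothesis iidZ : iid_continuous P Z.

Let mZ i : measurable_fun setT (Z i). Proof. by case: iidZ. Qed.

(** A pi-system generating the events that depend only on the coordinates listed by [f]. *)
Definition cylinders n (f : 'I_n -> I) : set (set Omega) :=
  [set B | exists A : 'I_n -> set (R * R), (forall j, measurable (A j)) /\
     B = \bigcap_j (Z (f j) @^-1` A j)].

Lemma cylinders_measurable n (f : 'I_n -> I) : cylinders f `<=` measurable.
Proof.
move=> _ [A [mA ->]]; apply: fin_bigcap_measurable => //= j _.
by rewrite -[X in measurable X]setTI; apply: mZ.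
Qed.

(** As functions of [B], both sides are finite measures. They agree on cylinders by the product rule
    in [iidZ], hence on the sigma-algebra that these generate. *)
Lemma cylinders_indep n (f : 'I_n.+1 -> I) (A : set (R * R)) (B : set Omega) :
  injective f -> measurable A -> <<s cylinders (f \o lift ord0) >> B ->
  P (B `&` Z (f ord0) @^-1` A) = (P B * P (Z (f ord0) @^-1` A))%E.
Proof.
move=> injf mA; have [_ prodZ _ _] := iidZ.
have mZA : measurable (Z (f ord0) @^-1` A).
  by rewrite -[X in measurable X]setTI; apply: mZ.
have pfin : P (Z (f ord0) @^-1` A) \is a fin_num by exact: fin_num_measure.
have p0 : (0 <= fine (P (Z (f ord0) @^-1` A)))%R by rewrite fine_ge0.
have cT : cylinders (f \o lift ord0) setT.
  exists (fun=> setT); split=> //.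
  by apply/seteqP; split.
move=> sB.
have scaleE C : mscale (NngNum p0) P C = (P C * P (Z (f ord0) @^-1` A))%E.
  by rewrite muleC -[X in (X * _)%E](fineK pfin).
rewrite -scaleE -[LHS]/(mrestr P mZA B).
apply: (g_sigma_algebra_measure_unique (cylinders (f \o lift ord0)) _ (fun=> setT)) => //.
- exact: cylinders_measurable.
- by apply/seteqP; split=> // x _; exists 0%N.
- move=> _ _ [A1 [mA1 ->]] [A2 [mA2 ->]].
  exists (fun j => A1 j `&` A2 j); split; first by move=> j; apply: measurableI.
  apply/seteqP; split=> [x [H1 H2] j _|x H]; first by split; [apply: H1|apply: H2].
  by split=> j _; case: (H j Logic.I).
- move=> _ [A1 [mA1 ->]]; apply: etrans (esym (scaleE _)); rewrite /mrestr /=.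
  pose A' j := if unlift ord0 j is Some j' then A1 j' else A.
  have mA' j : measurable (A' j) by rewrite /A'; case: unliftP.
  have := prodZ _ f injf A' mA'; rewrite big_ord_recl.
  have := prodZ _ (f \o lift ord0) _ A1 mA1.
  rewrite /A' unlift_none => -> //; last by apply: inj_comp => //; exact: lift_inj.
  under [in X in _ = X -> _]eq_bigr do rewrite liftK.
  rewrite muleC => <-; congr (P _).
  apply/seteqP; split=> [x [H1 H2] j _|x H].
    by case: unliftP => [j' ->|->] //; apply: H1.
  split=> [j _|]; last by have := H ord0 Logic.I; rewrite /= unlift_none.
  by have := H (lift ord0 j) Logic.I; rewrite /= liftK.
- move=> _; exact: le_lt_trans (probability_le1 P (measurableI _ _ measurableT mZA)) (ltry 1).
Qed.

(** A hybrid point for the induction: coordinates reached by [f] are random, the others are frozen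
    at [z0]. *)
Definition partial_point (z0 : I -> R[i]) n (f : 'I_n -> I) (w : Omega) (i : I) :=
  if `[< exists j, f j = i >] then toC (Z i w) else z0 i.

(** Induction on the number of random coordinates. Given the previous ones, [D] is a polynomial in
    the newly randomised coordinate, nonzero off a null event, so only finitely many values make it
    vanish. *)
Lemma partial_point_null (D : (I -> R[i]) -> R[i]) (z0 : I -> R[i]) :
  polyfun D -> D z0 != 0 ->
  forall n (f : 'I_n -> I), injective f ->
    P [set w | D (partial_point z0 f w) = 0] = 0%E.
Proof.
move=> pD Dz0; have [_ _ _ acZ] := iidZ.
elim=> [|n IH] f injf.
  rewrite (_ : mkset _ = set0) ?measure0 //.
  apply/seteqP; split=> // w /=.
  suff -> : partial_point z0 f w = z0 by move/eqP; rewrite (negPf Dz0).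
  apply: funext => i; rewrite /partial_point; case: asboolP => // -[[]] //.
pose f' := f \o lift ord0; pose i0 := f ord0.
have injf' : injective f' by apply: inj_comp => //; exact: lift_inj.
(* [upd z c] overwrites coordinate [i0] by [c], written as a move along a coordinate direction so
   that [polyfun_line] applies. *)
pose upd (z : I -> R[i]) c := fun i => z i + (c - z i0) * (`[< i = i0 >])%:R.
have updE w : partial_point z0 f w = upd (partial_point z0 f' w) (toC (Z i0 w)).
  apply: funext => i; rewrite /upd /partial_point.
  case: (pselect (i = i0)) => [->|ii0].
    rewrite (asboolT (erefl i0)) mulr1 addrC subrK asboolT //; by exists ord0.
  rewrite (asboolF ii0) mulr0 addr0; congr (if _ then _ else _).
  apply: asbool_equiv_eq; split=> -[j fj]; last by exists (lift ord0 j).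
  case: (unliftP ord0 j) => [j' jE|jE]; first by exists j'; rewrite /f' /= -jE.
  by case: ii0; rewrite -fj jE.
(* [O'] is [Omega] with only the events of the coordinates [f']; the identity into it is the
   variable [X] that is independent of [Z i0]. *)
pose O' := g_sigma_algebraType (cylinders f').
have mid : measurable_fun setT (id : Omega -> O').
  move=> _ B mB; rewrite setTI preimage_id.
  exact: (smallest_sub (@sigma_algebra_measurable _ Omega) (@cylinders_measurable _ f')).
pose X : {mfun Omega >-> O'} := mfun_Sub (mem_set mid).
pose Y : {mfun Omega >-> (R * R)%type} := mfun_Sub (mem_set (mZ i0)).
have mZ' (j : 'I_n) : measurable_fun setT (Z (f' j) : O' -> _).
  move=> _ B mB; rewrite setTI; apply: sub_sigma_algebra.
  exists (fun k => if k == j then B else setT); split.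
    by move=> k; case: ifP.
  apply/seteqP; split=> [x Bx k _ /=|x H]; last by have := H j Logic.I; rewrite /= eqxx.
  by case: eqP => [->|].
have mpp (i : I) : measurable_fun setT (fun w : O' => complex.Re (partial_point z0 f' w i)) /\
   measurable_fun setT (fun w : O' => complex.Im (partial_point z0 f' w i)).
  rewrite /partial_point; case: asboolP => [[j <-]|_]; last first.
    by split; apply: measurable_cst.
  by split; [apply: (measurableT_comp measurable_fst)|
             apply: (measurableT_comp measurable_snd)]; apply: mZ'.
pose E := [set p : O' * (R * R) | D (upd (partial_point z0 f' p.1) (toC p.2)) = 0].
pose N := [set w : O' | D (partial_point z0 f' w) = 0].
have mN : measurable N by apply: measurable_polyfun.
have mE : measurable E.
  (* The new value becomes an extra coordinate [None], so the condition defining [E] is itself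
     polynomial. *)
  have pupd : polyfun (fun z : option I -> R[i] =>
      D (fun i => z (Some i) + (z None - z (Some i0)) * (`[< i = i0 >])%:R)).
    elim: pD => [c|i|g h _ pg _ ph|g h _ pg _ ph].
    - exact: polyfun_const.
    - apply: polyfun_add; first exact: polyfun_coord.
      apply: polyfun_mul; last exact: polyfun_const.
      by apply: polyfun_add; [|apply: polyfun_opp]; apply: polyfun_coord.
    - exact: polyfun_add.
    - exact: polyfun_mul.
  pose u (p : O' * (R * R)) (o : option I) :=
    if o is Some i then partial_point z0 f' p.1 i else toC p.2.
  apply: (measurable_polyfun (u := u) pupd) => -[i|]; rewrite /u.
    by have [m1 m2] := mpp i; split;
      [apply: (measurableT_comp m1)|apply: (measurableT_comp m2)]; apply: measurable_fst.
  by split; [apply: (measurableT_comp measurable_fst)|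
             apply: (measurableT_comp measurable_snd)]; apply: measurable_snd.
have -> : [set w | D (partial_point z0 f w) = 0] = [set w | E (X w, Y w)].
  by apply/seteqP; split=> w /=; rewrite /E /= updE.
apply: (@xsection_null_prob _ _ _ _ _ _ _ P X Y E N) => //.
- by move=> A B mA mB; apply: cylinders_indep.
- exact: IH.
- move=> w Nw.
  have [p Hp] := polyfun_line (partial_point z0 f' w) (fun i => (`[< i = i0 >])%:R) pD.
  have p0 : p != 0.
    apply: contra_notN Nw => /eqP p0; rewrite /N /=.
    have := Hp 0; rewrite p0 horner0 => <-; congr D.
    by apply: funext => i; rewrite mul0r addr0.
  have [rs Hrs] : {rs : seq R[i] | forall x, root p x -> x \in rs}.
    have [rs /= Hrs] := closed_field_poly_normal p.
    exists rs => x; rewrite Hrs rootZ ?lead_coef_eq0 // root_prod_XsubC //.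
  have [ms s0] := lebesgue2_toC_seq [seq x + partial_point z0 f' w i0 | x <- rs].
  have msec : measurable (xsection E w) by exact: measurable_xsection.
  apply: acZ => //; apply/eqP; rewrite eq_le measure_ge0 andbT -s0.
  apply: le_measure; rewrite ?inE // => x; rewrite /xsection /= inE => Ex.
  apply/mapP; exists (toC x - partial_point z0 f' w i0); last by rewrite subrK.
  by apply: Hrs; rewrite /root -Hp; apply/eqP.
Qed.

End GenericPoint.

Lemma iid_continuous_generic (R : realType) (d : measure_display)
    (Omega : measurableType d) (P : probability Omega R) (I : finType)
    (Z : I -> Omega -> R * R) (D : (I -> R[i]) -> R[i]) :
  iid_continuous P Z -> polyfun D -> (exists z, D z != 0)%R ->
  measurable [set w | D (fun i => toC (Z i w)) = 0%R] /\
  P [set w | D (fun i => toC (Z i w)) = 0%R] = 0%E.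
Proof.
move=> iidZ pD [z0 Dz0]; split.
  apply: (measurable_polyfun pD) => i; have [mZ _ _ _] := iidZ.
  by split; [apply: (measurableT_comp measurable_fst)|
             apply: (measurableT_comp measurable_snd)]; apply: mZ.
(* [enum_val] reaches every index, so no frozen coordinate remains. *)
rewrite -[RHS](partial_point_null iidZ pD Dz0 (@enum_val_inj _ I)).
congr (P _); apply/seteqP; split=> w /= H; rewrite -[RHS]H; congr D;
  apply: funext => i; rewrite /partial_point asboolT //;
  by exists (enum_rank i); rewrite enum_rankK.
Qed.

(** * Zero forcing at the two base stations *)

Section ZeroForcing.
Local Open Scope ring_scope.

(** Block [(i, j)] of an identity matrix partitioned by [d]. Indices are compared through [val]
    because the blocks may be rectangular. *)
Definition delta_blk (F : comNzRingType) (K : nat) (d : 'I_K -> nat) (i j : 'I_K) :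
    'M[F]_(d i, d j) :=
  \matrix_(a, b) ((i == j) && (val a == val b))%:R.

Lemma trmx_delta_blk (F : comNzRingType) (K : nat) (d : 'I_K -> nat) (i j : 'I_K) :
  (delta_blk F d i j)^T = delta_blk F d j i.
Proof. by apply/matrixP => a b; rewrite !mxE eq_sym [val b == _]eq_sym. Qed.

Lemma mxcol_rinv (F : comNzRingType) (K m : nat) (p : 'I_K -> nat)
    (B : forall i, 'M[F]_(p i, m)) (X : 'M[F]_(m, \sum_i p i)) :
  (\mxcol_i B i) *m X = 1%:M ->
  forall i j, B i *m submxrow X j = delta_blk F p i j.
Proof.
move=> BX i j.
rewrite -[B i](mxcolK B) submxcol_mul mul_submxrow BX.
by apply/matrixP => a b; rewrite !mxE -val_eqE /= tagnat.eq_Rank.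
Qed.

(** [Y] is cut from a right inverse of the stacked [V l *m Hb l]. Then [X] comes from the first
    columns of a right inverse of the stacked [W k *m Ha k] placed over the interference rows, which
    fit by the bound on [Ma]. The [setP] hypothesis lets the three families of entries be prescribed
    independently. *)
Lemma zero_forcing (F : closedFieldType) (I : Type) (K L Ma Mb : nat)
    (Na da : 'I_K -> nat) (Nb db : 'I_L -> nat)
    (ea : forall k, 'I_(Na k) -> 'I_Ma -> I)
    (eb : forall l, 'I_(Nb l) -> 'I_Mb -> I)
    (ec : 'I_Mb -> 'I_Ma -> I) (keep : I -> Prop)
    (W : forall k, 'M[F]_(da k, Na k)) (Wr : forall k, 'M[F]_(Na k, da k))
    (V : forall l, 'M[F]_(db l, Nb l)) (Vr : forall l, 'M[F]_(Nb l, db l))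
    (D : (I -> F) -> F) (z : I -> F) :
  (forall k, W k *m Wr k = 1%:M) -> (forall l, V l *m Vr l = 1%:M) ->
  (forall (y : I -> F) (A : forall k, 'M[F]_(Na k, Ma))
      (B : forall l, 'M[F]_(Nb l, Mb)) (C : 'M[F]_(Mb, Ma)),
     exists y' : I -> F, [/\ forall k i j, y' (ea k i j) = A k i j,
       forall l i j, y' (eb l i j) = B l i j,
       forall i j, y' (ec i j) = C i j & forall i, keep i -> y' i = y i]) ->
  polyfun D -> D z != 0 ->
  (\sum_l db l <= Mb)%N -> (\sum_k da k + \sum_l db l <= Ma)%N ->
  exists (z' : I -> F) (X : forall k, 'M[F]_(Ma, da k)) (Y : forall l, 'M[F]_(Mb, db l)),
  [/\ D z' != 0, forall i, keep i -> z' i = z i,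
      forall k i, W k *m (\matrix_(a, b) z' (ea k a b)) *m X i = delta_blk F da k i,
      forall l j, V l *m (\matrix_(a, b) z' (eb l a b)) *m Y j = delta_blk F db l j &
      forall l k, (Y l)^T *m (\matrix_(a, b) z' (ec a b)) *m X k = 0].
Proof.
move=> WK VK setP pD Dz le1 le2.
pose Ha (y : I -> F) k : 'M[F]_(Na k, Ma) := \matrix_(a, b) y (ea k a b).
pose Hb (y : I -> F) l : 'M[F]_(Nb l, Mb) := \matrix_(a, b) y (eb l a b).
pose G (y : I -> F) : 'M[F]_(Mb, Ma) := \matrix_(a, b) y (ec a b).
have pcoord m n (e : 'I_m -> 'I_n -> I) :
    polyfun_mx (fun y : I -> F => \matrix_(i, j) y (e i j)).
  move=> i j; apply: (@polyfun_eq _ _ (fun y => y (e i j))).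
    by move=> y; rewrite mxE.
  exact: polyfun_coord.
have pmul m n p (A : 'M[F]_(m, n)) (e : 'I_n -> 'I_p -> I) i j :
    polyfun (fun y : I -> F => (A *m (\matrix_(a, b) y (e a b))) i j).
  exact: (polyfun_mulmx (@polyfun_mx_const _ I _ _ A) (pcoord _ _ e) i j).
pose N1 y := \mxcol_l (V l *m Hb y l).
have pN1 : polyfun_mx N1.
  move=> i j.
  apply: (@polyfun_eq _ _ (fun y => (V (tagnat.sig1 i) *m Hb y (tagnat.sig1 i)) (tagnat.sig2 i) j)).
    by move=> y; rewrite /N1 [RHS]mxE.
  exact: pmul.
pose J1 : 'M[F]_(\sum_l db l, Mb) := pid_mx (\sum_l db l).
have J1K : J1 *m pid_mx (\sum_l db l) = 1%:M.
  by rewrite mul_pid_mx minnn (minn_idPr le1) pid_mx_1.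
(* A sample channel at which [N1] is the truncated identity [J1] shows that a right inverse exists
   generically. *)
have [y1 [y1a y1b y1c y1k]] := setP z (Ha z) (fun l => Vr l *m submxcol J1 l) (G z).
have N1y : N1 y1 = J1.
  rewrite -[RHS]submxcolK; apply: eq_mxcol => l.
  have -> : Hb y1 l = Vr l *m submxcol J1 l.
    by apply/matrixP => i j; rewrite mxE y1b.
  by rewrite mulmxA VK mul1mx.
rewrite -N1y in J1K.
have [z1 [Dz1 [Yf N1Y] z1E]] := polyfun_rinv pD pN1 Dz J1K.
pose N2 y := col_mx (\mxcol_k (W k *m Ha y k)) (Yf^T *m G y).
have pN2 : polyfun_mx N2.
  move=> i j; rewrite -(splitK i); case: (fintype.split i) => i' /=.
    apply: (@polyfun_eq _ _ (fun y =>
        (W (tagnat.sig1 i') *m Ha y (tagnat.sig1 i')) (tagnat.sig2 i') j)).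
      by move=> y; rewrite [RHS]col_mxEu [RHS]mxE.
    exact: pmul.
  apply: (@polyfun_eq _ _ (fun y => (Yf^T *m G y) i' j)).
    by move=> y; rewrite [RHS]col_mxEd.
  exact: pmul.
pose J2 : 'M[F]_(\sum_k da k + \sum_l db l, Ma) := pid_mx (\sum_k da k + \sum_l db l).
have J2K : J2 *m pid_mx (\sum_k da k + \sum_l db l) = 1%:M.
  by rewrite mul_pid_mx minnn (minn_idPr le2) pid_mx_1.
(* The sample keeps the [eb] entries of [z1], so [Yf] remains a right inverse of [N1]; transposing
   [N1 z1 *m Yf = 1] shows that this choice of [G] produces [dsubmx J2]. *)
have [y2 [y2a y2b y2c y2k]] := setP z1 (fun k => Wr k *m submxcol (usubmx J2) k)
  (Hb z1) ((N1 z1)^T *m dsubmx J2).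
have N2y : N2 y2 = J2.
  rewrite /N2 -[RHS]vsubmxK; congr col_mx.
    rewrite -[RHS]submxcolK; apply: eq_mxcol => k.
    have -> : Ha y2 k = Wr k *m submxcol (usubmx J2) k.
      by apply/matrixP => i j; rewrite mxE y2a.
    by rewrite mulmxA WK mul1mx.
  have -> : G y2 = (N1 z1)^T *m dsubmx J2 by apply/matrixP => i j; rewrite mxE y2c.
  by rewrite mulmxA -trmx_mul N1Y trmx1 mul1mx.
rewrite -N2y in J2K.
have [z2 [Dz2 [X N2X] z2E]] := polyfun_rinv pD pN2 Dz1 J2K.
have Hb2 l : Hb z2 l = Hb z1 l.
  by apply/matrixP => i j; rewrite !mxE z2E // y2b mxE.
(* The first block column of the identity says that [lsubmx X] inverts the direct links and cancels
   the interference. *)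
rewrite -[X]hsubmxK /N2 mul_col_row scalar_mx_block in N2X.
have [Xa _ Xc _] := eq_block_mx N2X.
exists z2, (submxrow (lsubmx X)), (submxrow Yf); split=> //.
- by move=> i ki; rewrite z2E ?y2k // z1E ?y1k.
- by move=> k i; exact: (mxcol_rinv Xa k i).
- move=> l j; rewrite -[X in _ *m X *m _]/(Hb z2 l) Hb2.
  exact: (@mxcol_rinv _ _ _ _ (fun l => V l *m Hb z1 l) Yf N1Y l j).
- move=> l k; rewrite tr_submxrow submxcol_mul mul_submxrow submxcol_mul Xc.
  by rewrite submxcol0 submxrow0.
Qed.

End ZeroForcing.

(** * Finiteness of the set of channel entries *)

Section EntryFinite.
Variables (K L Ma Mb : nat) (Na : 'I_K -> nat) (Nb : 'I_L -> nat).

Let code := ({k : 'I_K & ('I_(Na k) * 'I_Ma)%type} +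
  {k : 'I_K & {l : 'I_L & ('I_(Na k) * 'I_(Nb l))%type}} +
  {l : 'I_L & ('I_Mb * 'I_(Nb l))%type} + 'I_Mb * 'I_Ma)%type.

(** Transports finiteness from a sum of sigma types; quantifier elimination needs a finite list of
    parameters. *)
Definition entry_code (e : @entry K L Ma Mb Na Nb) : code :=
  match e with
  | EHa k i j => inl (inl (inl (existT _ k (i, j))))
  | EGa k l i j => inl (inl (inr (existT _ k (existT _ l (i, j)))))
  | EHb l i j => inl (inr (existT _ l (i, j)))
  | EGb i j => inr (i, j)
  end.

Definition entry_decode (c : code) : @entry K L Ma Mb Na Nb :=
  match c with
  | inl (inl (inl (existT k (i, j)))) => @EHa K L Ma Mb Na Nb k i j
  | inl (inl (inr (existT k (existT l (i, j))))) => @EGa K L Ma Mb Na Nb k l i j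
  | inl (inr (existT l (i, j))) => @EHb K L Ma Mb Na Nb l i j
  | inr (i, j) => @EGb K L Ma Mb Na Nb i j
  end.

Lemma entry_codeK : cancel entry_code entry_decode.
Proof. by case. Qed.

HB.instance Definition _ := Equality.copy (@entry K L Ma Mb Na Nb) (can_type entry_codeK).
HB.instance Definition _ := Choice.copy (@entry K L Ma Mb Na Nb) (can_type entry_codeK).
HB.instance Definition _ := Countable.copy (@entry K L Ma Mb Na Nb) (can_type entry_codeK).
HB.instance Definition _ := Finite.copy (@entry K L Ma Mb Na Nb) (can_type entry_codeK).

End EntryFinite.

(** * Alignment of the links between users of different cells *)

Section Alignment.
Local Open Scope ring_scope.

Lemma sum_ord_split (V : nmodType) (d N : nat) (f : nat -> V) : (d <= N)%N ->
  \sum_(i < N) f i = \sum_(i < d) f i + \sum_(i < N - d) f (d + i)%N.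
Proof.
move=> dN; rewrite -!(big_mkord xpredT f) (@big_cat_nat _ _ _ d) //=; congr (_ + _).
by rewrite -[in LHS](add0n d) big_addn big_mkord; apply: eq_bigr => i _; rewrite addnC.
Qed.

(** Row [a] of a block matrix [[1 X]], with [x] as the row of [X]. It is indexed by [nat] to avoid
    casts, with default [0] beyond the tail. *)
Definition unit_tail (F : nzRingType) (d N : nat) (a : 'I_d) (x : 'I_(N - d) -> F)
    (i : nat) : F :=
  if (i < d)%N then (i == a)%:R else oapp x 0 (insub (i - d)%N).

Lemma sum_unit_tail (F : nzRingType) (d N : nat) (a : 'I_d) (x : 'I_(N - d) -> F)
    (h : nat -> F) : (d <= N)%N ->
  \sum_(i < N) unit_tail a x i * h i = h a + \sum_e x e * h (d + e)%N.
Proof.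
move=> dN; rewrite (@sum_ord_split _ d N (fun i => unit_tail a x i * h i)) //.
congr (_ + _).
  rewrite (bigD1 a) //= /unit_tail ltn_ord eqxx mul1r big1 ?addr0 // => i ia.
  by rewrite ltn_ord (_ : (i == a :> nat) = false) ?mul0r //; apply/negbTE.
apply: eq_bigr => e _.
by rewrite /unit_tail ltnNge leq_addr /= addKn valK.
Qed.

Variables (R : rcfType) (K L Ma Mb : nat) (Na : 'I_K -> nat) (Nb : 'I_L -> nat).
Variables (da : 'I_K -> nat) (db : 'I_L -> nat).
Hypothesis daN : forall k, (da k <= Na k)%N.
Hypothesis dbN : forall l, (db l <= Nb l)%N.
Local Notation F := R[i].
Local Notation I := (@entry K L Ma Mb Na Nb).
Local Notation GaRow := (GaRow da db).
Local Notation GaCol := (GaCol Na Nb da db).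
Local Notation row_of k l a b :=
  (existT (fun k : 'I_K => {l : 'I_L & ('I_(da k) * 'I_(db l))%type}) k
    (existT (fun l : 'I_L => ('I_(da k) * 'I_(db l))%type) l (a, b)) : GaRow).
Local Notation cola k a e :=
  (inl (existT (fun k : 'I_K => ('I_(da k) * 'I_(Na k - da k))%type) k (a, e)) : GaCol).
Local Notation colb l b e :=
  (inr (existT (fun l : 'I_L => ('I_(db l) * 'I_(Nb l - db l))%type) l (b, e)) : GaCol).
Local Notation G z k l := (Ga (channel_of z) k l).

Lemma polyfun_Galpha :
  polyfun_mx (fun z : I -> F => Galpha da db (Ga (channel_of z))).
Proof.
move=> i j; apply: (@polyfun_eq _ _ (fun z =>
  Galpha_entry (Ga (channel_of z)) (enum_val i) (enum_val j))).
  by move=> z; rewrite mxE.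
have pnat k l m n : polyfun (fun z : I -> F => mxnat (G z k l) m n).
  rewrite /mxnat; case: insub => [m'|]; last exact: polyfun_const.
  case: insub => [n'|]; last exact: polyfun_const.
  apply: (@polyfun_eq _ _ (fun z => z (@EGa K L Ma Mb Na Nb k l m' n'))).
    by move=> z; rewrite mxE.
  exact: polyfun_coord.
case: (enum_val i) => k [l [a b]].
by case: (enum_val j) => [[k' [a' e]]|[l' [b' e]]] /=;
  (case: (_ && _); [exact: pnat|exact: polyfun_const]).
Qed.

(** Entry [(a, b)] of [X_k G3 + G2 Y_l], where [t] lists the [X_k] by rows and the [Y_l] by
    columns. *)
Definition lin_part (z : I -> F) (t : GaCol -> F) (r : GaRow) : F :=
  let: existT k (existT l (a, b)) := r in
  \sum_(e < Na k - da k) t (cola k a e) * mxnat (G z k l) (da k + e) b +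
  \sum_(e < Nb l - db l) mxnat (G z k l) a (db l + e) * t (colb l b e).

(** Entry [(a, b)] of the remaining term [X_k G4 Y_l]. *)
Definition quad_part (z : I -> F) (t : GaCol -> F) (r : GaRow) : F :=
  let: existT k (existT l (a, b)) := r in
  \sum_(e < Na k - da k) \sum_(e' < Nb l - db l) t (cola k a e) * mxnat (G z k l) (da k + e) (db l + e') *
                 t (colb l b e').

(** Block row [(k, l)] meets only block columns [k] and [K + l], where the Kronecker deltas retain
    row [a] of [X_k] and column [b] of [Y_l]. *)
Lemma lin_partE (z : I -> F) (t : GaCol -> F) (r : GaRow) :
  lin_part z t r = \sum_c Galpha_entry (Ga (channel_of z)) r c * t c.
Proof.
case: r => k [l [a b]]; rewrite big_sumType /=; congr (_ + _).
  transitivity (\sum_(k' : 'I_K) \sum_(p : 'I_(da k') * 'I_(Na k' - da k'))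
    (if (k' == k) && (val p.1 == val a) then mxnat (G z k l) (da k + p.2) b else 0) *
     t (cola k' p.1 p.2)).
    rewrite (bigD1 k) //= [X in _ + X]big1 ?addr0 => [|k' /negPf k'k]; last first.
      by rewrite big1 // => p _; rewrite k'k mul0r.
    rewrite eqxx /= -(pair_big xpredT xpredT (fun (a' : 'I_(da k)) (e : 'I_(Na k - da k)) =>
      (if val a' == val a then mxnat (G z k l) (da k + e) b else 0) * t (cola k a' e))) /=.
    rewrite (bigD1 a) //= eqxx [X in _ + X]big1 ?addr0 => [|a' a'a].
      by apply: eq_bigr => e _; rewrite mulrC.
    rewrite big1 // => e _; rewrite (_ : (a' == a :> nat) = false) ?mul0r //.
    exact/negbTE.
  rewrite (sig_big_dep xpredT (fun=> xpredT) (fun k' (p : 'I_(da k') * 'I_(Na k' - da k')) =>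
    (if (k' == k) && (val p.1 == val a) then mxnat (G z k l) (da k + p.2) b else 0) *
     t (cola k' p.1 p.2))) /=.
  by apply: eq_bigr => -[k' [a' e]].
transitivity (\sum_(l' : 'I_L) \sum_(p : 'I_(db l') * 'I_(Nb l' - db l'))
    (if (l' == l) && (val p.1 == val b) then mxnat (G z k l) a (db l + p.2) else 0) *
     t (colb l' p.1 p.2)).
  rewrite (bigD1 l) //= [X in _ + X]big1 ?addr0 => [|l' /negPf l'l]; last first.
    by rewrite big1 // => p _; rewrite l'l mul0r.
  rewrite eqxx /= -(pair_big xpredT xpredT (fun (b' : 'I_(db l)) (e : 'I_(Nb l - db l)) =>
    (if val b' == val b then mxnat (G z k l) a (db l + e) else 0) * t (colb l b' e))) /=.
  rewrite (bigD1 b) //= eqxx [X in _ + X]big1 ?addr0 // => b' b'b.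
  rewrite big1 // => e _; rewrite (_ : (b' == b :> nat) = false) ?mul0r //.
  exact/negbTE.
rewrite (sig_big_dep xpredT (fun=> xpredT) (fun l' (p : 'I_(db l') * 'I_(Nb l' - db l')) =>
    (if (l' == l) && (val p.1 == val b) then mxnat (G z k l) a (db l + p.2) else 0) *
     t (colb l' p.1 p.2))) /=.
by apply: eq_bigr => -[l' [b' e]].
Qed.

Lemma lin_part_surj (z : I -> F) X (c : GaRow -> F) :
  Galpha da db (Ga (channel_of z)) *m X = 1%:M ->
  exists t, lin_part z t =1 c.
Proof.
move=> GX; pose cv : 'cV_#|{: GaRow}| := \col_i c (enum_val i).
exists (fun x => (X *m cv) (enum_rank x) 0) => r.
have : (Galpha da db (Ga (channel_of z)) *m (X *m cv)) (enum_rank r) 0 = c r.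
  by rewrite mulmxA GX mul1mx mxE enum_rankK.
rewrite lin_partE => <-; rewrite [RHS]mxE [RHS](reindex (@enum_rank GaCol)) /=.
  by apply: eq_bigr => x _; congr (_ * _); rewrite mxE !enum_rankK.
exact: onW_bij (enum_rank_bij _).
Qed.

(** Changes only the blocks [G1], on which neither [lin_part] nor [quad_part] depends, so the
    alignment equations can be solved for [G1] in terms of [(X, Y)]. *)
Definition set_block1 (z : I -> F) (c : GaRow -> F) (e : I) : F :=
  if e is EGa k l i j then
    if (insub (val i), insub (val j)) is (Some a, Some b) then c (row_of k l a b)
    else z e
  else z e.

Lemma set_block1D (z : I -> F) (c1 c2 : GaRow -> F) (e : I) :
  set_block1 z (fun r => c1 r + c2 r) e =
  set_block1 z c1 e + set_block1 (fun=> 0) c2 e.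
Proof.
case: e => [k i j|k l i j|l i j|i j] /=; rewrite ?addr0 //.
by case: insub => [a|]; [case: insub => [b|]|]; rewrite ?addr0.
Qed.

Lemma set_block1_id (z : I -> F) :
  set_block1 z (fun r => let: existT k (existT l (a, b)) := r in mxnat (G z k l) a b) = z.
Proof.
apply: funext => -[k i j|k l i j|l i j|i j] //=.
case: insubP => [a _ aE|//]; case: insubP => [b _ bE|//].
by rewrite aE bE /mxnat !valK mxE.
Qed.

Lemma mxnat_set_block1 (z : I -> F) c k l (a : 'I_(da k)) (b : 'I_(db l)) :
  mxnat (G (set_block1 z c) k l) a b = c (row_of k l a b).
Proof.
rewrite /mxnat (insubT (fun i => i < Na k)%N (leq_trans (ltn_ord a) (daN k))).
rewrite (insubT (fun i => i < Nb l)%N (leq_trans (ltn_ord b) (dbN l))).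
by rewrite mxE /= !valK.
Qed.

Lemma mxnat_set_block1_out (z : I -> F) c k l i j :
  (da k <= i)%N || (db l <= j)%N ->
  mxnat (G (set_block1 z c) k l) i j = mxnat (G z k l) i j.
Proof.
move=> out; rewrite /mxnat; case: insubP => [i' _ iE|//]; case: insubP => [j' _ jE|//].
rewrite !mxE /= iE jE; case: insubP => [a ai _|//]; case: insubP => [b bj _|//].
by move: out; rewrite leqNgt ai leqNgt bj.
Qed.

(** At a point where [D] is nonzero and [Galpha] has a right inverse, the linear part reaches every
    choice of [G1]. Then [polyfun_dominant] yields [(X, Y)] whose exact aligned block [G1] keeps [D]
    nonzero. *)
Lemma align_cross_links (D : (I -> F) -> F) (z1 z0 : I -> F) :
  polyfun D -> D z1 != 0 -> row_free (Galpha da db (Ga (channel_of z0))) ->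
  exists z (W : forall k, 'M[F]_(da k, Na k)) (Wr : forall k, 'M[F]_(Na k, da k))
    (V : forall l, 'M[F]_(db l, Nb l)) (Vr : forall l, 'M[F]_(Nb l, db l)),
  [/\ D z != 0, forall k l, W k *m G z k l *m (V l)^T = 0,
      forall k, W k *m Wr k = 1%:M & forall l, V l *m Vr l = 1%:M].
Proof.
move=> pD Dz1 /row_freeP[C GC].
have [z [Dz [X GX] _]] := polyfun_rinv pD polyfun_Galpha Dz1 GC.
(* Since [- lin_part z t1] is the block [G1] of [z], the linearised family passes through [z]
   itself, where [D] is nonzero. *)
have [t1 t1E] := lin_part_surj (fun r =>
  - (let: existT k (existT l (a, b)) := r in mxnat (G z k l) a b)) GX.
pose zero : I -> F := fun=> 0.
have [||||t Dt] := @polyfun_dominant F I (GaCol -> F) D (set_block1 z (fun=> 0))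
    (fun x t c => x * t c) (fun t => set_block1 zero (fun r => - lin_part z t r))
    (fun t => set_block1 zero (fun r => - quad_part z t r)) t1 pD.
- move=> x t [k i j|k l i j|l i j|i j] /=; rewrite ?mulr0 //.
  case: insub => [a|]; [case: insub => [b|]|]; rewrite ?mulr0 //.
  rewrite mulrN mulrDr !mulr_sumr; congr (- (_ + _)); apply: eq_bigr => e _.
    by rewrite mulrA.
  by rewrite mulrCA.
- move=> x t [k i j|k l i j|l i j|i j] /=; rewrite ?mulr0 //.
  case: insub => [a|]; [case: insub => [b|]|]; rewrite ?mulr0 //.
  rewrite mulrN mulr_sumr; congr (- _); apply: eq_bigr => e _.
  rewrite mulr_sumr; apply: eq_bigr => e' _.
  by rewrite expr2; ring.
- move=> x t; have [t' t'E] := lin_part_surj (fun r =>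
    lin_part z t r + x * quad_part z t r) GX.
  exists t' => -[k i j|k l i j|l i j|i j] /=; rewrite ?mulr0 ?addr0 //.
  case: insub => [a|]; [case: insub => [b|]|]; rewrite ?mulr0 ?addr0 //.
  rewrite -/(lin_part z t' (row_of k l a b)) t'E /=.
  by rewrite mulrN -opprD.
- suff -> : (fun i => set_block1 z (fun=> 0) i +
      set_block1 zero (fun r => - lin_part z t1 r) i) = z by [].
  rewrite -[RHS]set_block1_id; apply: funext => e.
  rewrite -set_block1D; congr (set_block1 _ _ _); apply: funext => r.
  by rewrite t1E opprK add0r.
have zE : (fun i => set_block1 z (fun=> 0) i +
    set_block1 zero (fun r => - lin_part z t r) i +
    set_block1 zero (fun r => - quad_part z t r) i) =
    set_block1 z (fun r => - lin_part z t r - quad_part z t r).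
  apply: funext => e; rewrite -!set_block1D; congr (set_block1 _ _ _).
  by apply: funext => r; rewrite add0r.
rewrite zE in Dt; set z3 := set_block1 z _ in Dt.
pose x k a := fun e => t (cola k a e); pose y l b := fun e => t (colb l b e).
(* [[1 v]] has the right inverse [[1; 0]] whatever [v] is. *)
have rinv d N (v : 'I_d -> 'I_(N - d) -> F) : (d <= N)%N ->
    (\matrix_(a < d, i < N) unit_tail a (v a) i) *m
    (\matrix_(i < N, a < d) (val i == val a)%:R) = 1%:M.
  move=> dN; apply/matrixP => a a'; rewrite !mxE.
  under eq_bigr do rewrite !mxE.
  rewrite (sum_unit_tail a (v a) (fun i => (i == val a')%:R)) // big1 ?addr0 //.
  move=> e _; rewrite (_ : (_ == _) = false) ?mulr0 //.
  by apply/negbTE; rewrite neq_ltn orbC (leq_trans (ltn_ord a')) ?leq_addr.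
exists z3, (fun k => \matrix_(a, i) unit_tail a (x k a) i),
  (fun k => \matrix_(i, a) (val i == val a)%:R),
  (fun l => \matrix_(b, j) unit_tail b (y l b) j),
  (fun l => \matrix_(j, b) (val j == val b)%:R); split=> //.
- move=> k l; apply/matrixP => a b; rewrite !mxE.
  (* The product splits into [G1 + X G3 + G2 Y + X G4 Y], which cancels by the choice of [G1] in
     [z3]. *)
  pose h i j := mxnat (G z3 k l) i j.
  pose s j := h a j + \sum_e x k a e * h (da k + e)%N j.
  transitivity (\sum_(j < Nb l) unit_tail b (y l b) j * s j).
    apply: eq_bigr => j _; rewrite !mxE mulrC; congr (_ * _).
    rewrite /s -(sum_unit_tail a (x k a) (fun i => h i j)) //; apply: eq_bigr => i _.
    by rewrite !mxE /h /mxnat !valK mxE.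
  have hab : h a b = - lin_part z t (row_of k l a b) - quad_part z t (row_of k l a b).
    by rewrite /h mxnat_set_block1.
  have ha e j : h (da k + e)%N j = mxnat (G z k l) (da k + e) j.
    by rewrite /h mxnat_set_block1_out ?leq_addr.
  have hb e : h a (db l + e)%N = mxnat (G z k l) a (db l + e).
    by rewrite /h mxnat_set_block1_out ?leq_addr ?orbT.
  rewrite (sum_unit_tail b (y l b) s) // /s hab /lin_part /quad_part.
  under [X in _ + X + _]eq_bigr do rewrite ha.
  under [X in _ + X]eq_bigr => e' _.
    rewrite hb mulrDr mulr_sumr.
    under eq_bigr do rewrite ha mulrC.
    over.
  rewrite big_split /= [X in _ + (_ + X)]exchange_big /=.
  under [X in _ + (X + _)]eq_bigr do rewrite mulrC.
  ring.
- by move=> k; apply: rinv.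
- by move=> l; apply: rinv.
Qed.

End Alignment.

(** * Density of aligned channels and generic feasibility *)

Section GenericFeasibility.
Local Open Scope ring_scope.
Variables (R : rcfType) (K L Ma Mb : nat) (Na : 'I_K -> nat) (Nb : 'I_L -> nat).
Variables (da : 'I_K -> nat) (db : 'I_L -> nat).
Local Notation F := R[i].
Local Notation I := (@entry K L Ma Mb Na Nb).

(* Feasibility with [W k], [Y l] for the conjugate transposes of the receive
   filters, normalised so that the direct links become identities: these are
   polynomial equations, whereas [ctr] is not a polynomial operation. *)
Definition aligned (ch : @channel R K L Ma Mb Na Nb)
    (W : forall k, 'M[F]_(da k, Na k)) (V : forall l, 'M[F]_(Nb l, db l))
    (X : forall k, 'M[F]_(Ma, da k)) (Y : forall l, 'M[F]_(db l, Mb)) :=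
  [/\ forall k l, W k *m Ga ch k l *m V l = 0,
      forall l k, Y l *m Gb ch *m X k = 0,
      forall k i, W k *m Ha ch k *m X i = delta_blk F da k i &
      forall l j, Y l *m Hb ch j *m V j = delta_blk F db l j].

Lemma ctrK m n (A : 'M[F]_(m, n)) : ctr (ctr A) = A.
Proof. by apply/matrixP => i j; rewrite !mxE; case: (A i j) => a b /=; rewrite opprK. Qed.

Lemma delta_blk_neq (p : nat) (d : 'I_p -> nat) i j : i != j -> delta_blk F d i j = 0.
Proof. by move=> /negPf ij; apply/matrixP => a b; rewrite !mxE ij. Qed.

Lemma delta_blk_diag (p : nat) (d : 'I_p -> nat) i : delta_blk F d i i = 1%:M.
Proof. by apply/matrixP => a b; rewrite !mxE eqxx. Qed.

Lemma aligned_feasible ch W V X Y : @aligned ch W V X Y -> feasible da db ch.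
Proof.
move=> [WV YX WX YV].
exists X, (fun k => ctr (W k)), V, (fun l => ctr (Y l)); split.
- by move=> k l; rewrite ctrK.
- by move=> k l; rewrite ctrK.
- by move=> k i ik; rewrite ctrK WX delta_blk_neq // eq_sym.
- by move=> l j jl; rewrite ctrK YV delta_blk_neq // eq_sym.
- by split=> [k|l]; rewrite ctrK ?WX ?YV delta_blk_diag mxrank1.
Qed.

(** Cross links are aligned first; zero forcing then alters only [Ha], [Hb] and [Gb], so the
    alignment survives. The base station with more antennas takes the role of [Ma] in
    [zero_forcing], the cells being exchanged by transposition when [Ma < Mb]. *)
Lemma aligned_dense (D : (I -> F) -> F) (z0 : I -> F) :
  (forall k, (da k <= Na k)%N) -> (forall l, (db l <= Nb l)%N) ->
  (\sum_k da k <= Ma)%N -> (\sum_l db l <= Mb)%N ->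
  (\sum_k da k + \sum_l db l <= maxn Ma Mb)%N ->
  row_free (Galpha da db (Ga (channel_of z0))) ->
  polyfun D -> (exists z, D z != 0) ->
  exists z : I -> F, D z != 0 /\ exists W V X Y, @aligned (channel_of z) W V X Y.
Proof.
move=> daN dbN leA leB leM Gfree pD [z1 Dz1].
have [z [W [Wr [V [Vr [Dz WGV WK VK]]]]]] := align_cross_links daN dbN pD Dz1 Gfree.
pose keep (e : I) := if e is EGa _ _ _ _ then True else False.
have keepG z' k l : (forall e, keep e -> z' e = z e) ->
    Ga (channel_of z') k l = Ga (channel_of z) k l.
  by move=> zE; apply/matrixP => i j; rewrite !mxE zE.
have HbT (z' : I -> F) l : (Hb (channel_of z') l)^T =
    \matrix_(a, b) z' (@EHb K L Ma Mb Na Nb l b a).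
  by apply/matrixP => a b; rewrite !mxE.
have GbT (z' : I -> F) : (Gb (channel_of z'))^T =
    \matrix_(a, b) z' (@EGb K L Ma Mb Na Nb b a).
  by apply/matrixP => a b; rewrite !mxE.
have [MbMa|MaMb] := leqP Mb Ma.
  rewrite (maxn_idPl MbMa) in leM.
  have [|z' [X [Y [Dz' zE WX VY YX]]]] := @zero_forcing F I K L Ma Mb Na da Nb db
    (fun k i j => @EHa K L Ma Mb Na Nb k i j) (fun l i j => @EHb K L Ma Mb Na Nb l j i)
    (fun i j => @EGb K L Ma Mb Na Nb i j) keep W Wr V Vr D z WK VK _ pD Dz leB leM.
    move=> y A B C; exists (fun e : I => match e with
      | EHa k i j => A k i j | EHb l i j => B l j i | EGb i j => C i j | _ => y e end).
    by split=> // -[].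
  exists z'; split=> //; exists W, (fun l => (V l)^T), X, (fun l => (Y l)^T); split.
  - by move=> k l; rewrite (keepG _ _ _ zE).
  - exact: YX.
  - exact: WX.
  - move=> l j; apply: trmx_inj; rewrite !trmx_mul !trmxK trmx_delta_blk mulmxA HbT.
    exact: VY.
rewrite (maxn_idPr (ltnW MaMb)) addnC in leM.
have [|z' [Y [X [Dz' zE VY WX YX]]]] := @zero_forcing F I L K Mb Ma Nb db Na da
    (fun l i j => @EHb K L Ma Mb Na Nb l j i) (fun k i j => @EHa K L Ma Mb Na Nb k i j)
    (fun i j => @EGb K L Ma Mb Na Nb j i) keep V Vr W Wr D z VK WK _ pD Dz leA leM.
  move=> y B A C; exists (fun e : I => match e with
    | EHa k i j => A k i j | EHb l i j => B l j i | EGb i j => C j i | _ => y e end).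
  by split=> // -[].
exists z'; split=> //; exists W, (fun l => (V l)^T), X, (fun l => (Y l)^T); split.
- by move=> k l; rewrite (keepG _ _ _ zE).
- move=> l k; apply: trmx_inj; rewrite !trmx_mul !trmxK trmx0 mulmxA GbT.
  exact: YX.
- exact: WX.
- move=> l j; apply: trmx_inj; rewrite !trmx_mul !trmxK trmx_delta_blk mulmxA HbT.
  exact: VY.
Qed.

(** Scalar entries of [W], [V], [X], [Y], in this order, as a finite type suited to
    [generic_solvable]. *)
Let unknown := (({k : 'I_K & ('I_(da k) * 'I_(Na k))%type} +
    {l : 'I_L & ('I_(Nb l) * 'I_(db l))%type}) +
  ({k : 'I_K & ('I_Ma * 'I_(da k))%type} +
    {l : 'I_L & ('I_(db l) * 'I_Mb)%type}))%type.

Let equation := (({k : 'I_K & {l : 'I_L & ('I_(da k) * 'I_(db l))%type}} +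
    {l : 'I_L & {k : 'I_K & ('I_(db l) * 'I_(da k))%type}}) +
  ({k : 'I_K & {i : 'I_K & ('I_(da k) * 'I_(da i))%type}} +
    {l : 'I_L & {j : 'I_L & ('I_(db l) * 'I_(db j))%type}}))%type.

Let pt := (I + unknown)%type -> F.
Let Wof (x : pt) k : 'M[F]_(da k, Na k) :=
  \matrix_(a, b) x (inr (inl (inl (existT _ k (a, b))))).
Let Vof (x : pt) l : 'M[F]_(Nb l, db l) :=
  \matrix_(a, b) x (inr (inl (inr (existT _ l (a, b))))).
Let Xof (x : pt) k : 'M[F]_(Ma, da k) :=
  \matrix_(a, b) x (inr (inr (inl (existT _ k (a, b))))).
Let Yof (x : pt) l : 'M[F]_(db l, Mb) :=
  \matrix_(a, b) x (inr (inr (inr (existT _ l (a, b))))).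
Let chof (x : pt) := channel_of (fun e : I => x (inl e)).

Let residual (q : equation) (x : pt) : F :=
  match q with
  | inl (inl (existT k (existT l (a, b)))) => (Wof x k *m Ga (chof x) k l *m Vof x l) a b
  | inl (inr (existT l (existT k (a, b)))) => (Yof x l *m Gb (chof x) *m Xof x k) a b
  | inr (inl (existT k (existT i (a, b)))) =>
      (Wof x k *m Ha (chof x) k *m Xof x i) a b - delta_blk F da k i a b
  | inr (inr (existT l (existT j (a, b)))) =>
      (Yof x l *m Hb (chof x) j *m Vof x j) a b - delta_blk F db l j a b
  end.

Let residual_polyfun q : polyfun (residual q).
Proof.
have pcoord m n (e : 'I_m -> 'I_n -> (I + unknown)%type) :
    polyfun_mx (fun x : pt => \matrix_(i, j) x (e i j)).
  move=> i j; apply: (@polyfun_eq _ _ (fun x => x (e i j))).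
    by move=> x; rewrite mxE.
  exact: polyfun_coord.
have pmul m n p r (e1 : 'I_m -> 'I_n -> (I + unknown)%type)
    (e2 : 'I_n -> 'I_p -> (I + unknown)%type) (e3 : 'I_p -> 'I_r -> (I + unknown)%type) a b :
    polyfun (fun x : pt => ((\matrix_(i, j) x (e1 i j)) *m (\matrix_(i, j) x (e2 i j)) *m
      (\matrix_(i, j) x (e3 i j))) a b).
  exact: (polyfun_mulmx (polyfun_mulmx (pcoord _ _ e1) (pcoord _ _ e2)) (pcoord _ _ e3) a b).
case: q => [[[k [l [a b]]]|[l [k [a b]]]]|[[k [i [a b]]]|[l [j [a b]]]]] /=.
- exact: pmul.
- exact: pmul.
- by apply: polyfun_add; [exact: pmul|exact: polyfun_const].
- by apply: polyfun_add; [exact: pmul|exact: polyfun_const].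
Qed.

(** One channel [z0] of full row rank makes aligned channels dense, and [generic_solvable] upgrades
    density to solvability off a hypersurface. *)
Lemma generic_feasible (z0 : I -> F) :
  (forall k, (da k <= Na k)%N) -> (forall l, (db l <= Nb l)%N) ->
  (\sum_k da k <= Ma)%N -> (\sum_l db l <= Mb)%N ->
  (\sum_k da k + \sum_l db l <= maxn Ma Mb)%N ->
  row_free (Galpha da db (Ga (channel_of z0))) ->
  exists D : (I -> F) -> F, [/\ polyfun D, exists z, D z != 0 &
    forall z, D z != 0 -> feasible da db (channel_of z)].
Proof.
move=> daN dbN leA leB leM Gfree.
have [D pD nD|D [pD nD HD]] := @generic_solvable F I unknown equation residual residual_polyfun.
  have [z [Dz [W [V [X [Y [WV YX WX YV]]]]]]] := aligned_dense daN dbN leA leB leM Gfree pD nD.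
  exists z => //; exists (fun u : unknown => match u with
    | inl (inl (existT k (a, b))) => W k a b
    | inl (inr (existT l (a, b))) => V l a b
    | inr (inl (existT k (a, b))) => X k a b
    | inr (inr (existT l (a, b))) => Y l a b end) => q.
  set x : pt := fun _ => _.
  have WE k : Wof x k = W k by apply/matrixP => a b; rewrite mxE.
  have VE l : Vof x l = V l by apply/matrixP => a b; rewrite mxE.
  have XE k : Xof x k = X k by apply/matrixP => a b; rewrite mxE.
  have YE l : Yof x l = Y l by apply/matrixP => a b; rewrite mxE.
  have chE : chof x = channel_of z by [].
  case: q => [[[k [l [a b]]]|[l [k [a b]]]]|[[k [i [a b]]]|[l [j [a b]]]]];
    rewrite /residual ?WE ?VE ?XE ?YE chE.
  - by rewrite WV mxE.
  - by rewrite YX mxE.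
  - by rewrite WX subrr.
  - by rewrite YV subrr.
exists D; split=> // z /HD[t Ht].
set x : pt := fun _ => _ in Ht.
apply: (@aligned_feasible _ (Wof x) (Vof x) (Xof x) (Yof x)); split.
- move=> k l; apply/matrixP => a b; rewrite [RHS]mxE.
  exact: (Ht (inl (inl (existT _ k (existT _ l (a, b)))))).
- move=> l k; apply/matrixP => a b; rewrite [RHS]mxE.
  exact: (Ht (inl (inr (existT _ l (existT _ k (a, b)))))).
- move=> k i; apply/matrixP => a b; apply/eqP; rewrite -subr_eq0; apply/eqP.
  exact: (Ht (inr (inl (existT _ k (existT _ i (a, b)))))).
- move=> l j; apply/matrixP => a b; apply/eqP; rewrite -subr_eq0; apply/eqP.
  exact: (Ht (inr (inr (existT _ l (existT _ j (a, b)))))).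
Qed.

End GenericFeasibility.

(** * Passage from generic to almost sure feasibility *)

Unset Implicit Arguments.

Theorem theorem2 (R : realType) (K L Ma Mb : nat)
    (Na : 'I_K -> nat) (Nb : 'I_L -> nat)
    (da : 'I_K -> nat) (db : 'I_L -> nat)
    (d : measure_display) (Omega : measurableType d) (P : probability Omega R)
    (Z : @entry K L Ma Mb Na Nb -> Omega -> R * R) :
  iid_continuous P Z ->
  (forall k, (0 < da k <= Na k)%N) ->
  (forall l, (0 < db l <= Nb l)%N) ->
  (\sum_(k < K) da k <= Ma)%N ->
  (\sum_(l < L) db l <= Mb)%N ->
  (\sum_(k < K) da k + \sum_(l < L) db l <= maxn Ma Mb)%N ->
  {ae P, forall w : Omega,
     let ch := channel_of (fun e => toC (Z e w)) in
     row_free (Galpha da db (Ga ch)) -> feasible da db ch}.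
Proof.
move=> iidZ daP dbP leA leB leM.
have daN k : (da k <= Na k)%N by case/andP: (daP k).
have dbN l : (db l <= Nb l)%N by case/andP: (dbP l).
(* The rank condition bears on the realised channel. If no channel satisfies it the claim is
   vacuous; otherwise one deterministic [z0] gives a single [D] serving all outcomes. *)
have [[z0 Gfree]|nofree] := pselect (exists z0 : @entry K L Ma Mb Na Nb -> R[i],
    row_free (Galpha da db (Ga (channel_of z0)))); last first.
  apply: aeW => w /= Gfree; case: nofree; by exists (fun e => toC (Z e w)).
have [D [pD nD HD]] := generic_feasible daN dbN leA leB leM Gfree.
have [mD D0] := iid_continuous_generic iidZ pD nD.
exists [set w | D (fun e => toC (Z e w)) = 0%R]; split=> // w /= nfeas.
apply: contrapT => /eqP /HD feas; apply: nfeas => _; exact: feas.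
Qed.
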